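(* In the SLAR setting, let $(\delta^*,w^* )$ be any Nash equilibrium of the SLAR game. Then for every non-robust feature $x_i$ we have $w_i^*=0$.
   Context: SLAR setting: $(x,y)$ is drawn from a distribution $\mathcal D$ on $\mathbb R^d\times\{-1,+1\}$, $x=(x_1,\dots,x_d)$ with finite second moments, such that (A1) for each $i$ there is a constant $\mu_i$ with $\mathbb E[x_i\mid y]=y\mu_i$ for $y\in\{-1,1\}$, and (A2) the coordinates $x_1,\dots,x_d$ are mutually independent conditionally on $y$. Fix $\lambda>0$ and a perturbation budget $\varepsilon>0$; $\mathcal B(\varepsilon)=\{a\in\mathbb R^d:\|a\|_\infty\le\varepsilon\}$. A perturbation function is a measurable map $\delta$ assigning to each $(x,y)$ a vector $\delta(x,y)\in\mathcal B(\varepsilon)$. For a perturbation function $\delta$ and $w\in\mathbb R^d$ let $U(\delta,w)=\mathbb E_{(x,y)\sim\mathcal D}[\max(0,1-yw^\top(x+\delta(x,y)))]+\frac{\lambda}{2}\|w\|_2^2$. A feature $x_i$ is non-robust if $|\mu_i|\le\varepsilon$, and robust otherwise. SLAR game: the adversary chooses a perturbation function $\delta$, the defender chooses $w\in\mathbb R^d$; the adversary's payoff is $U(\delta,w)$ and the defender's is $-U(\delta,w)$. A pair $(\delta^*,w^* )$ is a (pure) Nash equilibrium if $\sup_\delta U(\delta,w^* )\le U(\delta^*,w^* )\le\inf_{w\in\mathbb R^d}U(\delta^*,w)$, the supremum over all perturbation functions. *)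

(* Defs.v *)
From HB Require Import structures.
From mathcomp Require Import all_boot all_order all_algebra.
From mathcomp Require Import all_classical all_reals all_analysis.
Set Implicit Arguments. Unset Strict Implicit. Unset Printing Implicit Defensive.
Import Order.TTheory GRing.Theory Num.Theory.
Import numFieldNormedType.Exports.
Local Open Scope classical_set_scope.
Local Open Scope ring_scope.

(* The sample space R^d x R; a sample is z = (x, y) with x : d.-tuple R
   (coordinates x_i = tnth x i) and y : R (the label, a.s. in {-1,+1}).
   d.-tuple R carries the product (= Borel) sigma-algebra of the library. *)
Notation sample R d := (d.-tuple R * R)%type.

Section slar.
Context {R : realType} {d : nat}.

Definition label_event (c : R) : set (sample R d) := [set z | z.2 = c].

Definition coords_event (A : 'I_d -> set R) : set (sample R d) :=
  [set z | forall i, A i (tnth z.1 i)].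

(* elementary conditional probability P(E | y = c), used only when P(y=c) <> 0 *)
Definition condP (D : probability (sample R d) R) (c : R) (E : set (sample R d)) : R :=
  fine (D (E `&` label_event c)) / fine (D (label_event c)).

(* (A1): E[x_i | y] = y mu_i, i.e. (defining property of conditional expectation
   w.r.t. the discrete sigma-algebra of y) E[x_i 1_{y=c}] = c mu_i P(y = c). *)
Definition cond_mean_assumption (D : probability (sample R d) R) (mu : 'I_d -> R) :=
  forall (i : 'I_d) (c : R), (c = 1 \/ c = -1) ->
    (\int[D]_(z in label_event c) (tnth z.1 i)%:E = (c * mu i)%:E * D (label_event c))%E.

Definition cond_indep_assumption (D : probability (sample R d) R) :=
  forall (c : R), (c = 1 \/ c = -1) -> D (label_event c) <> 0%E ->
  forall A : 'I_d -> set R, (forall i, measurable (A i)) ->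
    condP D c (coords_event A) =
    \prod_(i < d) condP D c (coords_event (fun j => if j == i then A i else setT)).

Definition slar_distribution (D : probability (sample R d) R) (mu : 'I_d -> R) :=
  [/\ D (label_event 1 `|` label_event (-1)) = 1%E,
      (forall i : 'I_d, D.-integrable setT (fun z : sample R d => ((tnth z.1 i) ^+ 2)%:E)),
      cond_mean_assumption D mu &
      cond_indep_assumption D].

Definition perturbation (eps : R) (delta : sample R d -> d.-tuple R) :=
  measurable_fun setT delta /\ forall z i, `|tnth (delta z) i| <= eps.

Definition hinge (delta : sample R d -> d.-tuple R) (w : d.-tuple R) (z : sample R d) : R :=
  Num.max 0 (1 - z.2 * \sum_(i < d) tnth w i * (tnth z.1 i + tnth (delta z) i)).

Definition sqnorm (w : d.-tuple R) : R := \sum_(i < d) (tnth w i) ^+ 2.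

(* U(delta, w), valued in the extended reals (the expectation of a nonnegative
   function). *)
Definition U (D : probability (sample R d) R) (lam : R)
    (delta : sample R d -> d.-tuple R) (w : d.-tuple R) : \bar R :=
  (\int[D]_z (hinge delta w z)%:E + (lam / 2 * sqnorm w)%:E)%E.

Definition nash_equilibrium (D : probability (sample R d) R) (lam eps : R)
    (delta_s : sample R d -> d.-tuple R) (w_s : d.-tuple R) :=
  [/\ perturbation eps delta_s,
      (forall delta, perturbation eps delta -> (U D lam delta w_s <= U D lam delta_s w_s)%E) &
      (forall w, (U D lam delta_s w_s <= U D lam delta_s w)%E)].

Definition non_robust (mu : 'I_d -> R) (eps : R) (i : 'I_d) := `|mu i| <= eps.

End slar.

(* Main.v *)
Require Import Defs.
From HB Require Import structures.
From mathcomp Require Import all_boot all_order all_algebra.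
From mathcomp Require Import all_classical all_reals all_analysis.
From mathcomp Require Import measurable_realfun ring lra.
Import Order.TTheory GRing.Theory Num.Theory.
Local Open Scope classical_set_scope.
Local Open Scope ring_scope.

(** Against a fixed [w] the adversary's best response shifts every coordinate
    by [eps] against the label, so on [y = c] the hinge argument becomes
    [worst_margin c w x = 1 - c <w, x> + eps |w|_1].  Hence at an equilibrium
    [w_s] minimizes the worst-case objective.  Zeroing the coordinate [i] of
    [w_s] lowers the argument by [H = eps |w_i| - c w_i x_i], whose conditional
    mean [eps |w_i| - w_i mu_i] is nonnegative when the feature is non-robust.
    Writing [F] for the remaining margin, which given [y] is independent of
    [x_i], one has [E max(0, F + H) >= E 1_{F > 0} (F + H) >= E max(0, F)], so
    zeroing [w_i] does not increase the expected loss while it decreases the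
    regularizer by [lam / 2 * w_i ^ 2]. *)

(** * Integration against scaled and restricted measures *)

Section scaled_restricted_measures.
Context {d : measure_display} {T : measurableType d} {R : realType}.
Local Open Scope ereal_scope.

Lemma integral_mscale (m : {measure set T -> \bar R}) (k : {nonneg R})
    (f : T -> \bar R) : m.-integrable setT f ->
  \int[mscale k m]_x f x = k%:num%:E * \int[m]_x f x.
Proof.
move=> intf; have mf := measurable_int _ intf.
rewrite [LHS]integralE ge0_integral_mscale//; last exact: measurable_funepos.
rewrite ge0_integral_mscale//; last exact: measurable_funeneg.
by rewrite -muleBr// ?integrable_add_def// -integralE.
Qed.

(** The restricted measure gives no mass to the complement of [C] and agrees with [m] on subsets of
    [C]. *)
Lemma integral_mrestr (m : {measure set T -> \bar R}) (C : set T)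
    (mC : measurable C) (f : T -> \bar R) : measurable_fun setT f ->
  \int[mrestr m mC]_x f x = \int[m]_(x in C) f x.
Proof.
move=> mf; rewrite -(setUv C) integral_setU//; last 3 first.
- exact: measurableC.
- by rewrite setUv.
- by rewrite disj_set2E setICr.
rewrite [X in _ + X]null_set_integral ?adde0//.
- by apply: eq_measure_integral => A mA AC; rewrite /= /mrestr setIidl.
- exact: measurableC.
- exact: measurable_funTS.
- by rewrite /= /mrestr setICl measure0.
Qed.

End scaled_restricted_measures.

(** * Conditional means under independence, and comparison of hinge integrals *)

Section integral_comparisons.
Context {d : measure_display} {T : measurableType d} {R : realType}.
Local Open Scope ereal_scope.

(** A form of E[X | C] = E[X | E], cross-multiplied so that null events are covered. Each side is
    the integral of the identity of [R] against a scaled law of [X], and the hypothesis says that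
    these two laws agree on every measurable set. *)
Lemma integral_indep (m : {finite_measure set T -> \bar R})
    (X : T -> R) (C E : set T) : measurable_fun setT X ->
  measurable C -> measurable E -> m.-integrable setT (EFin \o X) ->
  (forall S : set R, measurable S ->
     m (X @^-1` S `&` C) * m E = m (X @^-1` S `&` E) * m C) ->
  m E * \int[m]_(x in C) (X x)%:E = m C * \int[m]_(x in E) (X x)%:E.
Proof.
move=> mX mC mE iX indep.
(* [mscale] takes a nonnegative real factor; [m] is finite, so [fine] preserves the mass. *)
pose q A : {nonneg R} := NngNum (fine_ge0 (measure_ge0 m A)).
have scaled (A B : set T) (mA : measurable A) (mB : measurable B) :
    m A * \int[m]_(x in B) (X x)%:E =
    \int[mscale (q A) (pushforward (mrestr m mB) X)]_y (y%:E).
  have mEX : measurable_fun setT (EFin \o X) by exact/measurable_EFinP.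
  have iB : (mrestr m mB).-integrable setT (EFin \o X).
    apply/integrableP; split => //.
    rewrite integral_mrestr//; last exact: measurableT_comp.
    have /integrableP[_] : m.-integrable B (EFin \o X) by exact: integrableS iX.
    by [].
  have iP : (pushforward (mrestr m mB) X).-integrable setT (fun y : R => y%:E).
    apply: integrable_pushforward => //.
    by apply/measurable_EFinP; exact: measurable_id.
  rewrite integral_mscale//.
  rewrite integral_pushforward//.
  by rewrite preimage_setT integral_mrestr//= fineK ?fin_num_measure.
rewrite (scaled mX E C mE mC) (scaled mX C E mC mE).
apply: eq_measure_integral => S mS _.
rewrite /= /mscale /= /pushforward /mrestr /= !fineK ?fin_num_measure//.
by rewrite muleC indep// muleC.
Qed.

(** [H] may change sign: only its integral over the part of [E] where [F] is positive has to be
    nonnegative, because the hinge of [F] vanishes elsewhere. *)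
Lemma le_integral_hinge (m : {measure set T -> \bar R}) (E : set T)
    (F H : T -> R) : measurable E ->
  m.-integrable E (EFin \o F) -> m.-integrable E (EFin \o H) ->
  0 <= \int[m]_(x in E `&` [set x | (0 < F x)%R]) (H x)%:E ->
  \int[m]_(x in E) (Num.max 0 (F x))%:E <=
  \int[m]_(x in E) (Num.max 0 (F x + H x))%:E.
Proof.
move=> mE iF iH H0.
have mF : measurable_fun E F by apply/measurable_EFinP; exact: measurable_int iF.
have mH : measurable_fun E H by apply/measurable_EFinP; exact: measurable_int iH.
set B := E `&` _ in H0 *.
have mB : measurable B.
  have := @measurable_fun_ltr _ _ _ E (cst 0%R) F (measurable_cst _) mF mE.
  by move=> /(_ [set true]) /=; apply.
have BE : B `<=` E by exact: subIsetl.
have iFB : m.-integrable B (EFin \o F) by exact: integrableS iF.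
have iHB : m.-integrable B (EFin \o H) by exact: integrableS iH.
have mM (G : T -> R) : measurable_fun E G ->
    measurable_fun E (fun x => (Num.max 0 (G x))%:E).
  move=> mG; apply/measurable_EFinP.
  by apply: measurable_maxr => //; exact: measurable_cst.
have -> : \int[m]_(x in E) (Num.max 0 (F x))%:E = \int[m]_(x in B) (F x)%:E.
  rewrite /B integral_mkcondr; apply: eq_integral => x _.
  rewrite patchE; case: ifPn; rewrite ?inE ?notin_setE /= => Fx.
    by rewrite max_r// ltW.
  by rewrite max_l// leNgt; apply/negP.
(* Three increases follow: adding [H] on [B], by [H0]; replacing [F + H] by its positive part;
   enlarging [B] to [E] for a nonnegative integrand. *)
apply: (@le_trans _ _ (\int[m]_(x in B) ((F x)%:E + (H x)%:E))).
  by rewrite integralD//= leeDl.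
apply: (@le_trans _ _ (\int[m]_(x in B) (Num.max 0 (F x + H x))%:E)).
  apply: le_integral => //.
  - exact: integrableD.
  - apply: (le_integrable mB _ _ (integrableD mB iFB iHB)).
      by apply: measurable_funS (mM _ (measurable_funD mF mH)).
    move=> x _; rewrite /= lee_fin.
    by case: (leP 0%R (F x + H x)%R) => // _; rewrite normr0.
  - by move=> x _; rewrite -EFinD lee_fin le_max lexx orbT.
apply: ge0_subset_integral => //.
- exact: mM (measurable_funD mF mH).
- by move=> x _; rewrite lee_fin le_max lexx.
Qed.

End integral_comparisons.

(** * Measurable rectangles as a generating pi-system of the product sigma-algebra *)

Section boxes.
Context {R : realType} {n : nat}.

Definition box (A : 'I_n -> set R) : set (n.-tuple R) :=
  [set x | forall i, A i (tnth x i)].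

Definition boxes : set (set (n.-tuple R)) :=
  [set box A | A in [set A | forall i, measurable (A i)]].

Lemma measurable_box (A : 'I_n -> set R) :
  (forall i, measurable (A i)) -> measurable (box A).
Proof.
move=> mA.
have -> : box A = \big[setI/setT]_(i < n) ((@tnth n R)^~ i @^-1` A i).
  rewrite -bigcap_seq; apply/seteqP; split => [x Ax i _|x Ax i]; first exact: Ax.
  by apply: Ax; rewrite /= mem_index_enum.
apply: bigsetI_measurable => i _.
by rewrite -[X in measurable X]setTI; exact: measurable_tnth.
Qed.

(** The library sigma-algebra is generated by preimages under the coordinates, and such a preimage
    is a box whose other sides are all [setT]. *)
Lemma measurable_tuple_boxes : @measurable _ (n.-tuple R) = <<s boxes >>.
Proof.
apply/seteqP; split.
- apply: smallest_sub; first exact: smallest_sigma_algebra.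
  rewrite -bigcup_seq => B [i _ [S mS <-]].
  apply: sub_sigma_algebra; exists (fun j => if j == i then S else setT).
    by move=> j; case: ifP.
  rewrite setTI; apply/seteqP; split => x /=; first by move/(_ i); rewrite eqxx.
  by move=> Sx j /=; case: eqP => // ->.
- apply: smallest_sub; first exact: sigma_algebra_measurable.
  by move=> _ [A mA <-]; exact: measurable_box.
Qed.

Lemma setI_closed_boxes : setI_closed boxes.
Proof.
move=> _ _ [A mA <-] [B mB <-]; exists (fun i => A i `&` B i).
  by move=> i; exact: measurableI.
apply/seteqP; split => [x ABx|x [Ax Bx] i]; last by split.
by split=> i; have [] := ABx i.
Qed.

(** Overwriting a coordinate, instead of deleting it, keeps the length [n]. The same map then serves
    to zero a weight and to express dependence on the other coordinates of a sample. *)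
Definition zero_coord (i : 'I_n) (x : n.-tuple R) : n.-tuple R :=
  [tuple if j == i then 0 else tnth x j | j < n].

Lemma tnth_zero_coord i x j :
  tnth (zero_coord i x) j = if j == i then 0 else tnth x j.
Proof. exact: tnth_mktuple. Qed.

Lemma measurable_zero_coord i : measurable_fun setT (zero_coord i).
Proof.
apply/measurable_fun_tnthP => j.
rewrite [X in measurable_fun _ X](_ : _ =
    (fun x : n.-tuple R => if j == i then 0 else tnth x j)).
  by case: (j == i); [exact: measurable_cst|exact: measurable_tnth].
by apply/funext => x /=; rewrite tnth_zero_coord.
Qed.

End boxes.

(** * From the product formula on rectangles to independence of one coordinate from all the
    others *)

Section conditional_independence.
Context {R : realType} {d : nat} (D : probability (sample R d) R).
Implicit Types (i : 'I_d) (c : R).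

Lemma measurable_coord i :
  measurable_fun setT (fun z : sample R d => tnth z.1 i).
Proof.
by apply: (measurableT_comp (measurable_tnth i)); exact: measurable_fst.
Qed.

Lemma measurable_label_event c : measurable (label_event c : set (sample R d)).
Proof.
rewrite -[label_event c]setTI.
exact: (@measurable_snd _ _ (d.-tuple R) R measurableT _ (measurable_set1 c)).
Qed.

Lemma measurable_coords_event (A : 'I_d -> set R) :
  (forall i, measurable (A i)) -> measurable (coords_event A).
Proof.
move=> mA; rewrite -[coords_event A]setTI.
exact: (@measurable_fst _ _ (d.-tuple R) R measurableT _ (measurable_box _ mA)).
Qed.

Lemma condP_setT c : D (label_event c) <> 0%E ->
  forall A : 'I_d -> set R, (forall i, A i = setT) ->
  condP D c (coords_event A) = 1.
Proof.
move=> D0 A AT; rewrite /condP (_ : coords_event A = setT).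
  rewrite setTI divff// fine_eq0 ?fin_num_measure//; first exact/eqP.
  exact: measurable_label_event.
by apply/seteqP; split=> // z _ j; rewrite AT.
Qed.

(** The product formula is applied twice, to [A] and to [A] with side [i] replaced by [setT]; in the
    second product the factor of index [i] is 1. *)
Lemma condP_coordI c i (A : 'I_d -> set R) : cond_indep_assumption D ->
  c = 1 \/ c = -1 -> D (label_event c) <> 0%E -> (forall j, measurable (A j)) ->
  condP D c (coords_event A) =
  condP D c (coords_event (fun j => if j == i then A i else setT)) *
  condP D c (coords_event (fun j => if j == i then setT else A j)).
Proof.
move=> indep c1 D0 mA; rewrite [in LHS]indep// (bigD1 i)//=; congr (_ * _).
rewrite indep//; last by move=> j; case: ifP.
rewrite [RHS](bigD1 i)//= condP_setT ?mul1r//; last first.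
  by move=> j; rewrite eqxx; case: ifP.
by apply: eq_bigr => j /negbTE ->.
Qed.

(** Given the label, [x_i] is independent of the vector of the other coordinates. With [S] fixed,
    both sides are finite measures in [B]; they agree on boxes, hence everywhere.
    Cross-multiplication also covers a label of probability zero. *)
Lemma zero_coord_indep c i (S : set R) (B : set (d.-tuple R)) :
  cond_indep_assumption D -> c = 1 \/ c = -1 -> measurable S -> measurable B ->
  let C := [set z : sample R d | B (zero_coord i z.1)] `&` label_event c in
  (D ((fun z => tnth z.1 i) @^-1` S `&` C) * D (label_event c) =
   D ((fun z => tnth z.1 i) @^-1` S `&` label_event c) * D C)%E.
Proof.
move=> indep c1 mS mB /=.
set E := label_event c; set X := fun z : sample R d => tnth z.1 i.
pose Z (z : sample R d) := zero_coord i z.1.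
have mE : measurable E := measurable_label_event c.
have mXS : measurable (X @^-1` S).
  by rewrite -[X in measurable X]setTI; exact: measurable_coord.
have mZ : measurable_fun setT Z.
  by apply: (measurableT_comp (measurable_zero_coord i)); exact: measurable_fst.
have mZB : measurable (Z @^-1` B) by rewrite -[X in measurable X]setTI; exact: mZ.
have [D0|/eqP D0] := eqVneq (D E) 0%E.
  rewrite D0 mule0 (_ : D (_ `&` E) = 0%E) ?mul0e//.
  by apply: (subset_measure0 _ mE _ D0) => //; exact: measurableI.
have mXE : measurable (X @^-1` S `&` E) by exact: measurableI.
pose q A : {nonneg R} := NngNum (fine_ge0 (measure_ge0 D A)).
(* The two sides of the goal, as measures of the variable set [B]. *)
pose m1 := mscale (q E) (pushforward (mrestr D mXE) Z).
pose m2 := mscale (q (X @^-1` S `&` E)) (pushforward (mrestr D mE) Z).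
suff : m1 mZ B = m2 mZ B.
  rewrite /m1 /m2 /mscale /pushforward /mrestr /= !fineK ?fin_num_measure// => e.
  by rewrite setICA muleC [LHS]e.
apply: (measure_unique boxes (fun=> setT)) => //.
- exact: measurable_tuple_boxes.
- exact: setI_closed_boxes.
- move=> _; exists (fun=> setT); first by move=> j; exact: measurableT.
  by apply/seteqP; split.
- by rewrite bigcup_const.
- move=> _ [A mA <-].
  change ((fine (D E))%:E * D (Z @^-1` box A `&` (X @^-1` S `&` E)) =
    (fine (D (X @^-1` S `&` E)))%:E * D (Z @^-1` box A `&` E))%E.
  pose A' S' j := if j == i then S' else A j.
  have mA' S' : measurable S' -> forall j, measurable (A' S' j).
    by move=> mS' j; rewrite /A'; case: ifP.
  (* Coordinate [i] of [Z z] is always 0. So side [A i] either excludes every sample or imposes no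
     condition, and in the latter case the preimage of the box is a rectangle with side [setT] at
     [i]. *)
  have [A0|A0] := pselect (A i 0); last first.
    have -> : Z @^-1` box A = set0.
      apply/seteqP; split=> // z /(_ i).
      by rewrite tnth_zero_coord eqxx => /A0.
    by rewrite !set0I measure0 !mule0.
  have eT : Z @^-1` box A = coords_event (A' setT).
    apply/seteqP; split=> z Az j; have := Az j; rewrite /A' tnth_zero_coord.
      by case: ifP.
    by case: eqP => // ->.
  have eS : Z @^-1` box A `&` (X @^-1` S `&` E) = coords_event (A' S) `&` E.
    rewrite setIA eT; congr (_ `&` _); apply/seteqP; split.
      by move=> z [Az Sz] j; have := Az j; rewrite /A'; case: eqP => // ->.
    move=> z Az; split.
      by move=> j; have := Az j; rewrite /A'; case: ifP.
    by have := Az i; rewrite /A' eqxx.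
  have eX : X @^-1` S `&` E =
      coords_event (fun j => if j == i then A' S i else setT) `&` E.
    congr (_ `&` _); apply/seteqP; split=> z.
      by move=> Sz j; rewrite /A' eqxx; case: eqP => // ->.
    by move=> /(_ i); rewrite /A' eqxx.
  have eR : (fun j => if j == i then setT else A' S j) = A' setT.
    by apply/funext => j; rewrite /A'; case: (j == i).
  have := condP_coordI c i (A' S) indep c1 D0 (mA' _ mS).
  rewrite eR /condP -eX -eS -eT -/E.
  have fE : fine (D E) != 0.
    by rewrite fine_eq0 ?fin_num_measure//; exact/eqP.
  move=> h.
  rewrite -[D (Z @^-1` _ `&` (_ `&` E))]fineK ?fin_num_measure//; last first.
    rewrite eS; apply: measurableI => //.
    exact: measurable_coords_event (mA' _ mS).
  rewrite -[D (Z @^-1` _ `&` E)]fineK ?fin_num_measure//; last first.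
    rewrite eT; apply: measurableI => //.
    exact: measurable_coords_event (mA' _ measurableT).
  rewrite -!EFinM; congr (_%:E).
  by rewrite -[fine (D (Z @^-1` _ `&` (_ `&` E)))](divfK fE) h; field.
(* Uniqueness of measures also asks for finite mass on the exhausting sequence, here constantly
   [setT]. *)
- move=> _.
  change ((fine (D E))%:E * D (Z @^-1` setT `&` (X @^-1` S `&` E)) < +oo)%E.
  rewrite preimage_setT setTI -ge0_fin_numE ?mule_ge0 ?lee_fin ?fine_ge0//.
  by rewrite fin_numM// fin_num_measure.
Qed.

End conditional_independence.

(** * Worst-case margins in the SLAR setting *)

Section slar_game.
Context {R : realType} {d : nat} (D : probability (sample R d) R).
Variables (mu : 'I_d -> R) (eps : R).
Hypotheses (slar : slar_distribution D mu) (eps0 : 0 < eps).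
Implicit Types (i : 'I_d) (c : R) (w x : d.-tuple R) (z : sample R d).

(** Second moments dominate first ones through |t| <= 1 + t^2, the constant 1 being integrable for a
    probability. *)
Lemma integrable_coord i :
  D.-integrable setT (fun z : sample R d => (tnth z.1 i)%:E).
Proof.
have [_ /(_ i) i2 _ _] := slar.
have i1 := finite_measure_integrable_cst D 1 measurableT.
apply: (le_integrable measurableT _ _ (integrableD measurableT i1 i2)).
  by apply/measurable_EFinP; exact: measurable_coord.
move=> z _; rewrite /= lee_fin; set t := tnth _ _.
rewrite [leRHS]ger0_norm ?addr_ge0 ?sqr_ge0// ler_norml.
by apply/andP; split; nra.
Qed.

Lemma measurable_zero_coord_event i (B : set (d.-tuple R)) : measurable B ->
  measurable [set z : sample R d | B (zero_coord i z.1)].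
Proof.
move=> mB.
have mZ : measurable_fun setT (fun z : sample R d => zero_coord i z.1).
  by apply: (measurableT_comp (measurable_zero_coord i)); exact: measurable_fst.
by have := mZ measurableT B mB; rewrite setTI.
Qed.

(** Conditioning further on an event about the other coordinates leaves the mean [c * mu i] of [x_i]
    unchanged: this is [integral_indep] combined with (A1), after cancelling the mass of the label
    event when it is positive. *)
Lemma integral_coord_zero_coord c i (B : set (d.-tuple R)) :
  c = 1 \/ c = -1 -> measurable B ->
  let C := [set z : sample R d | B (zero_coord i z.1)] `&` label_event c in
  (\int[D]_(z in C) (tnth z.1 i)%:E = (c * mu i)%:E * D C)%E.
Proof.
move=> c1 mB C; have [_ _ mean indep] := slar.
have mE := measurable_label_event (d := d) c.
have mC : measurable C.
  by apply: measurableI => //; exact: measurable_zero_coord_event.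
have [D0|D0] := eqVneq (D (label_event c)) 0%E.
  have DC : D C = 0%E by apply: (subset_measure0 mC mE _ D0); exact: subIsetr.
  rewrite null_set_integral ?DC ?mule0//.
  by apply/measurable_EFinP/measurable_funTS; exact: measurable_coord.
have := integral_indep D (fun z => tnth z.1 i) C (label_event c)
  (measurable_coord i) mC mE (integrable_coord i)
  (fun S mS => zero_coord_indep D c i S B indep c1 mS mB).
have DE : (0 < D (label_event c))%E by rewrite lt0e D0 measure_ge0.
rewrite mean// => e; apply: (inc_inj (lee_pmul2l (fin_num_measure D _ mE) DE)).
by rewrite [LHS]e muleCA [RHS]muleCA; congr (_ * _)%E; rewrite muleC.
Qed.

(** The term in [eps] is the support function of the sup-norm ball of radius [eps] at [w], that is,
    [eps] times the dual l1 norm. The label is a parameter [c], which makes the expression affine in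
    [x]. *)
Definition worst_margin c w x : R :=
  1 - c * \sum_(j < d) tnth w j * tnth x j + eps * \sum_(j < d) `|tnth w j|.

(** This puts the event of a positive remaining margin in the form that [integral_coord_zero_coord]
    requires. *)
Lemma worst_margin_zero_coordr c i w x :
  worst_margin c (zero_coord i w) (zero_coord i x) =
  worst_margin c (zero_coord i w) x.
Proof.
rewrite /worst_margin; do 2 congr (_ + _); congr (- (_ * _)).
by apply: eq_bigr => j _; rewrite !tnth_zero_coord; case: ifP; rewrite ?mul0r.
Qed.

Lemma worst_margin_zero_coord c i w x :
  worst_margin c w x = worst_margin c (zero_coord i w) x +
    (eps * `|tnth w i| - c * tnth w i * tnth x i).
Proof.
rewrite /worst_margin (bigD1 i)//= [X in eps * X](bigD1 i)//=.
rewrite [in RHS](bigD1 i)//= [X in _ + eps * X + _](bigD1 i)//=.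
rewrite !tnth_zero_coord eqxx.
rewrite [X in _ = 1 - c * (_ + X) + _ + _](eq_bigr
  (fun j => tnth w j * tnth x j)); last first.
  by move=> j /negbTE ji; rewrite tnth_zero_coord ji.
rewrite [X in _ = _ + eps * (_ + X) + _](eq_bigr (fun j => `|tnth w j|)); last first.
  by move=> j /negbTE ji; rewrite tnth_zero_coord ji.
by rewrite normr0; ring.
Qed.

Lemma measurable_worst_margin c w : measurable_fun setT (worst_margin c w).
Proof.
apply: measurable_funD; last exact: measurable_cst.
apply: measurable_funB; first exact: measurable_cst.
apply: measurable_funM; first exact: measurable_cst.
apply: measurable_sum => j; apply: measurable_funM; first exact: measurable_cst.
exact: measurable_tnth.
Qed.

Lemma integrable_worst_margin c w :
  D.-integrable setT (fun z => (worst_margin c w z.1)%:E).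
Proof.
pose a := 1 + eps * \sum_(j < d) `|tnth w j|.
have -> : (fun z : sample R d => (worst_margin c w z.1)%:E) =
    (fun z => a%:E + \sum_(j < d) (- c * tnth w j)%:E * (tnth z.1 j)%:E)%E.
  apply/funext => z.
  under eq_bigr do rewrite -EFinM.
  rewrite sumEFin -EFinD /worst_margin /a mulr_sumr -sumrN addrAC; congr (_ + _)%:E.
  by apply: eq_bigr => j _; ring.
apply: integrableD => //; first exact: finite_measure_integrable_cst.
by apply: integrable_sum => // j _; apply: integrableZl => //; exact: integrable_coord.
Qed.

Lemma le_worst_hinge_zero_coord c i w : c = 1 \/ c = -1 -> non_robust mu eps i ->
  (\int[D]_(z in label_event c)
      (Num.max 0 (worst_margin c (zero_coord i w) z.1))%:E <=
   \int[D]_(z in label_event c) (Num.max 0 (worst_margin c w z.1))%:E)%E.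
Proof.
move=> c1 nr.
have mE := measurable_label_event (d := d) c.
pose H z := eps * `|tnth w i| - c * tnth w i * tnth z.1 i.
have HE z : (H z)%:E = ((eps * `|tnth w i|)%:E +
    (- (c * tnth w i))%:E * (tnth z.1 i)%:E)%E.
  by rewrite -EFinM -EFinD mulNr.
have iH : D.-integrable setT (EFin \o H).
  rewrite [EFin \o H](funext HE).
  apply: integrableD => //; first exact: finite_measure_integrable_cst.
  by apply: integrableZl => //; exact: integrable_coord.
under [leRHS]eq_integral do rewrite (worst_margin_zero_coord c i).
apply: (le_integral_hinge D _ _ H) => //.
- by apply: integrableS (integrable_worst_margin c (zero_coord i w)).
- by apply: integrableS iH.
pose B := [set x | 0 < worst_margin c (zero_coord i w) x].
have mB : measurable B.
  have mW := measurable_worst_margin c (zero_coord i w).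
  have := @measurable_fun_ltr _ _ _ setT (cst 0) _ (measurable_cst _) mW.
  by move=> /(_ measurableT [set true]) /=; rewrite setTI; apply.
have eB : label_event c `&` [set z | 0 < worst_margin c (zero_coord i w) z.1] =
    [set z : sample R d | B (zero_coord i z.1)] `&` label_event c.
  rewrite setIC; congr (_ `&` _).
  by apply/seteqP; split => z /=; rewrite /B /= worst_margin_zero_coordr.
rewrite eB.
set C := _ `&` label_event c.
have mC : measurable C.
  by apply: measurableI => //; exact: measurable_zero_coord_event.
under eq_integral do rewrite HE.
have iC : D.-integrable C (fun z => (tnth z.1 i)%:E).
  by apply: integrableS (integrable_coord i).
rewrite integralD//; last 2 first.
- exact: finite_measure_integrable_cst.
- exact: integrableZl.
(* Since [c * c = 1], the integral of [H] over [C] equals [eps * |w_i| - w_i * mu i] times the mass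
   of [C], which is nonnegative because [|mu i| <= eps]. *)
rewrite integral_cst// integralZl// integral_coord_zero_coord// muleA -EFinM.
rewrite -muleDl ?fin_num_measure// ?fin_num_adde_defr// -EFinD mule_ge0// lee_fin.
have cc : c * c = 1 by case: c1 => ->; rewrite ?mulrNN mulr1.
have -> : - (c * tnth w i) * (c * mu i) = - (tnth w i * mu i).
  by rewrite -[RHS]mulr1 -cc; ring.
by rewrite subr_ge0 (le_trans (ler_norm _))// normrM mulrC ler_wpM2r.
Qed.

(** Labels outside {-1, 1} form a null set, and the two label events are disjoint. *)
Lemma integral_labels (g : sample R d -> R) : measurable_fun setT g ->
  (forall z, 0 <= g z) ->
  (\int[D]_z (g z)%:E = \int[D]_(z in label_event 1) (g z)%:E +
                        \int[D]_(z in label_event (-1)) (g z)%:E)%E.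
Proof.
move=> mg g0; have [Dlab _ _ _] := slar.
have mE c := measurable_label_event (d := d) c.
have mL := measurableU _ _ (mE 1) (mE (-1)).
have mEg : measurable_fun setT (EFin \o g) by exact/measurable_EFinP.
rewrite (ge0_negligible_integral (measurableC mL))//; last 2 first.
- by move=> z _; rewrite lee_fin.
- by rewrite -[LHS]/(D _) probability_setC// Dlab subee.
rewrite setTD setCK ge0_integral_setU//.
- exact: measurable_funTS.
- by move=> z _; rewrite lee_fin.
- rewrite disj_set2E; apply/eqP/seteqP; split=> // z [z1 zN1].
  have : (1 : R) = -1 := etrans (esym z1) zN1.
  by move/eqP; rewrite gt_eqF// (lt_trans (ltrN10 _) ltr01).
Qed.

(** * The adversary's best response and the worst-case expected loss *)

Lemma measurable_hinge (delta : sample R d -> d.-tuple R) w :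
  measurable_fun setT delta -> measurable_fun setT (hinge delta w).
Proof.
move=> mdelta; apply: measurable_maxr; first exact: measurable_cst.
apply: measurable_funB; first exact: measurable_cst.
apply: measurable_funM; first exact: measurable_snd.
apply: measurable_sum => j; apply: measurable_funM; first exact: measurable_cst.
apply: measurable_funD; first exact: measurable_coord.
exact: (measurableT_comp (measurable_tnth j)).
Qed.

(** On labels 1 and -1 this is [- y * eps * sg w_j]. Testing the sign of [z.2] gives a measurable
    map within the budget for every real label. *)
Definition worst_perturbation w z : d.-tuple R :=
  [tuple (if 0 < z.2 then - eps else eps) * Num.sg (tnth w j) | j < d].

Lemma worst_perturbationP w : perturbation eps (worst_perturbation w).
Proof.
split=> [|z j]; last first.
  rewrite tnth_mktuple normrM normr_sg.
  by case: ifP => _; rewrite ?normrN gtr0_norm//; case: eqP => _;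
    rewrite ?mulr1 ?mulr0// ltW.
apply/measurable_fun_tnthP => j.
rewrite [X in measurable_fun _ X](_ : _ =
    (fun z : sample R d => (if 0 < z.2 then - eps else eps) * Num.sg (tnth w j))).
  apply: measurable_funM; last exact: measurable_cst.
  apply: measurable_fun_ifT; [|exact: measurable_cst..].
  apply: measurable_fun_ltr; first exact: measurable_cst.
  exact: measurable_snd.
by apply/funext => z; rewrite /= tnth_mktuple.
Qed.

Lemma hinge_worst_perturbation c w z : c = 1 \/ c = -1 -> label_event c z ->
  hinge (worst_perturbation w) w z = Num.max 0 (worst_margin c w z.1).
Proof.
rewrite /label_event /= => c1 zc; rewrite /hinge zc; congr Num.max.
rewrite /worst_margin -addrA; congr (_ + _).
rewrite !mulr_sumr -!sumrN -big_split/=; apply: eq_bigr => j _.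
rewrite tnth_mktuple zc normrEsg.
by case: c1 => ->; rewrite ?ltr01 ?ltr0N1; ring.
Qed.

(** Coordinatewise, [- c * w_j * delta_j] is at most [eps * |w_j|]. *)
Lemma hinge_le_worst c delta w z : c = 1 \/ c = -1 -> label_event c z ->
  perturbation eps delta -> hinge delta w z <= Num.max 0 (worst_margin c w z.1).
Proof.
rewrite /label_event /= => c1 zc [_ dle]; rewrite /hinge zc.
rewrite ge_max !le_max lexx /=; apply/orP; right.
rewrite /worst_margin -addrA lerD2l !mulr_sumr -!sumrN -big_split/=.
apply: ler_sum => j _.
rewrite mulrDr mulrDr opprD lerD2l (le_trans (ler_norm _))// normrN !normrM.
have -> : `|c| = 1 by case: c1 => ->; rewrite ?normrN normr1.
by rewrite mul1r mulrC ler_wpM2r.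
Qed.

Lemma integral_hinge_worst w :
  (\int[D]_z (hinge (worst_perturbation w) w z)%:E =
   \int[D]_(z in label_event 1) (Num.max 0 (worst_margin 1 w z.1))%:E +
   \int[D]_(z in label_event (-1)) (Num.max 0 (worst_margin (-1) w z.1))%:E)%E.
Proof.
have [mdelta _] := worst_perturbationP w.
rewrite integral_labels; last 2 first.
- exact: measurable_hinge.
- by move=> z; rewrite le_max lexx.
by congr (_ + _)%E; apply: eq_integral => z /[!inE] zc; congr (_%:E);
  apply: hinge_worst_perturbation => //; [left|right].
Qed.

Lemma integral_hinge_le_worst delta w : perturbation eps delta ->
  (\int[D]_z (hinge delta w z)%:E <=
   \int[D]_z (hinge (worst_perturbation w) w z)%:E)%E.
Proof.
move=> pdelta; have [mdelta _] := pdelta; have mh := measurable_hinge _ w mdelta.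
have h0 z : 0 <= hinge delta w z by rewrite le_max lexx.
rewrite integral_hinge_worst integral_labels//.
have le c : c = 1 \/ c = -1 -> (\int[D]_(z in label_event c) (hinge delta w z)%:E <=
    \int[D]_(z in label_event c) (Num.max 0 (worst_margin c w z.1))%:E)%E.
  move=> c1; apply: ge0_le_integral.
  - exact: measurable_label_event.
  - by move=> z _; rewrite lee_fin.
  - by apply/measurable_EFinP; exact: measurable_funTS.
  - apply/measurable_EFinP/measurable_funTS.
    apply: measurable_maxr; first exact: measurable_cst.
    by apply: (measurableT_comp (measurable_worst_margin c w)); exact: measurable_fst.
  - by move=> z zc; rewrite lee_fin; exact: hinge_le_worst.
by apply: leeD; apply: le; [left|right].
Qed.

(** Finiteness lets the equilibrium inequalities be compared as inequalities between reals. The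
    hinge is dominated by the absolute value of the integrable margin. *)
Lemma integral_hinge_worst_fin_num w :
  (\int[D]_z (hinge (worst_perturbation w) w z)%:E)%E \is a fin_num.
Proof.
have fin c : (\int[D]_(z in label_event c)
    (Num.max 0 (worst_margin c w z.1))%:E)%E \is a fin_num.
  apply: integrable_fin_num; first exact: measurable_label_event.
  apply: (@integrableS _ _ _ _ setT) => //; first exact: measurable_label_event.
  apply: (le_integrable measurableT _ _ (integrable_worst_margin c w)).
    apply/measurable_EFinP.
    apply: measurable_maxr; first exact: measurable_cst.
    by apply: (measurableT_comp (measurable_worst_margin c w)); exact: measurable_fst.
  move=> z _; rewrite /= lee_fin.
  by case: (leP 0 (worst_margin c w z.1)) => // _; rewrite normr0.
by rewrite integral_hinge_worst fin_numD !fin.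
Qed.

Lemma sqnorm_zero_coord i w : sqnorm w = sqnorm (zero_coord i w) + tnth w i ^+ 2.
Proof.
rewrite /sqnorm (bigD1 i)//= [in RHS](bigD1 i)//= tnth_zero_coord eqxx expr0n add0r.
rewrite addrC; congr (_ + _).
by apply: eq_bigr => j /negbTE ji; rewrite tnth_zero_coord ji.
Qed.

End slar_game.

(** * Deviations of both players at an equilibrium *)

Theorem mainTheorem14 (R : realType) (d : nat)
    (D : probability (sample R d) R) (mu : 'I_d -> R) (lam eps : R)
    (delta_s : sample R d -> d.-tuple R) (w_s : d.-tuple R) :
  slar_distribution D mu -> 0 < lam -> 0 < eps ->
  nash_equilibrium D lam eps delta_s w_s ->
  forall i : 'I_d, non_robust mu eps i -> tnth w_s i = 0.
Proof.
move=> slar lam0 eps0 [pdelta best_delta best_w] i nr.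
pose V w := (\int[D]_z (hinge (worst_perturbation eps w) w z)%:E)%E.
pose w' := zero_coord i w_s.
have Vfin w : V w \is a fin_num by exact: integral_hinge_worst_fin_num slar eps0 w.
have leV : (V w' <= V w_s)%E.
  rewrite /V !(integral_hinge_worst D mu eps slar eps0); apply: leeD;
    apply: (le_worst_hinge_zero_coord D mu) => //; [by left|by right].
(* The adversary may deviate to the worst perturbation for [w_s], then the defender to [w']; finally
   the loss of [w'] under [delta_s] is at most its worst-case loss. *)
have leU : (V w_s + (lam / 2 * sqnorm w_s)%:E <= V w' + (lam / 2 * sqnorm w')%:E)%E.
  apply: (le_trans (best_delta _ (worst_perturbationP eps eps0 w_s))).
  apply: (le_trans (best_w w')); rewrite leeD2r//.
  exact: (integral_hinge_le_worst D mu).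
move: leV leU; rewrite -(fineK (Vfin w')) -(fineK (Vfin w_s)) -!EFinD !lee_fin.
rewrite (sqnorm_zero_coord i w_s) -/w' mulrDr => leV leU.
(* Adding [leV] and [leU] cancels the losses and the common part of the regularizer, leaving
   [lam / 2 * w_i ^ 2 <= 0]. *)
have : tnth w_s i ^+ 2 <= 0 by rewrite -(pmulr_rle0 _ (divr_gt0 lam0 (ltr0n _ 2))); lra.
by rewrite le_eqVlt sqrf_eq0 ltNge sqr_ge0 orbF => /eqP.
Qed.
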